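(* Let $(U_n)_{n\in\mathbb N}$ be a sequence of random variables such that $U_n$ has the discrete uniform distribution on $\{j/n: j=1,\dots,n\}$. Let $(R_n)_{n\in\mathbb N}$ be a sequence of random variables, independent of $(U_n)_{n\in\mathbb N}$, such that $R_n$ has the continuous uniform distribution on $[0,a_n]$, where $(a_n)_{n\in\mathbb N}$ is any sequence of positive numbers such that $n\,a_n\to\infty$ and $a_n\to0$ as $n\to\infty$. For each $n\in\mathbb N$ define $X_n=U_n+R_n$ and $Y_n=-R_n$. Then: (1) $X_n$ and $Y_n$ are absolutely continuous with respect to the Lebesgue measure on $\mathbb R$. (2) $U_n$ converges in distribution to $U$ as $n\to\infty$, where $U$ is (continuously) uniformly distributed on $[0,1]$. (3) $Y_n\to0$ in probability as $n\to\infty$. (4) $\lim_{n\to\infty}d_{\mathrm{TV}}(X_n,U)=0$. (5) $d_{\mathrm{TV}}(X_n+Y_n,U)=1$ for all $n\in\mathbb N$.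
   Context: $d_{\mathrm{TV}}(X,Y)=\sup_A|\mathbb P(X\in A)-\mathbb P(Y\in A)|$ over Borel sets $A$ denotes the total variation distance between the laws of $X$ and $Y$. *)

(* Defs.v *)
From HB Require Import structures.
From mathcomp Require Import all_boot all_order all_algebra.
From mathcomp Require Import all_classical all_reals all_analysis.
From mathcomp Require Import measurable_realfun.

Set Implicit Arguments.
Unset Strict Implicit.
Unset Printing Implicit Defensive.

Import Order.TTheory GRing.Theory Num.Theory.
Import numFieldNormedType.Exports.

Local Open Scope classical_set_scope.
Local Open Scope ring_scope.

Section probability_notions.
Context {R : realType} {d d' : measure_display}.
Context {T : measurableType d} {T' : measurableType d'}.
Variables (P : probability T R) (Q : probability T' R).

(* A point mass 1/n at each of the n distinct points j/n already adds up to 1,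
   so no condition outside these points is needed (for 0 < n). *)
Definition discrete_uniform (X : {RV P >-> R}) (n : nat) : Prop :=
  forall j : nat, (1 <= j <= n)%N ->
    P [set t | X t = j%:R / n%:R] = (n%:R^-1)%:E.

Definition continuous_uniform (X : {RV P >-> R}) (a b : R) (ab : a < b) : Prop :=
  forall A : set R, measurable A -> distribution P X A = uniform_prob ab A.

Definition sigma_family (D : set nat) (X : nat -> {RV P >-> R}) : set (set T) :=
  <<s \bigcup_(n in D) preimage_set_system setT (X n) measurable >>.

(* Independence of the two sequences from each other; nothing is assumed about
   the dependence within each sequence. *)
Definition independent_sequences (D : set nat) (X Y : nat -> {RV P >-> R}) : Prop :=
  forall A B : set T, sigma_family D X A -> sigma_family D Y B ->
    P (A `&` B) = (P A * P B)%E.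

(* The limit may live on a different probability space. *)
Definition cvg_in_distribution (X : nat -> {RV P >-> R}) (Y : {RV Q >-> R}) : Prop :=
  forall x : R, {for x, continuous (cdf Y)} ->
    cdf (X n) x @[n --> \oo] --> cdf Y x.

Definition cvg_in_probability (X : nat -> {RV P >-> R}) (Z : T -> R) : Prop :=
  forall eps : R, 0 < eps ->
    P [set t | eps <= `|X n t - Z t|] @[n --> \oo] --> 0%E.

Definition dTV (X : {RV P >-> R}) (Y : {RV Q >-> R}) : \bar R :=
  ereal_sup [set `|distribution P X A - distribution Q Y A|%E
            | A in (measurable : set (set R))].

End probability_notions.

(* Main.v *)
(* Conditioning on U_n and using translation invariance of Lebesgue measure mu,
   P(X_n \in A) <= (n a)^-1 \sum_(1 <= j <= n) mu (A `&` [j/n, j/n + a])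
   where a = a_n.
   If K > n a, intervals whose indices are congruent modulo K are disjoint, so
   with K <= n a + 1 the sum is at most (n a + 1) mu (A `&` [0, 1 + a]).  Hence
   P(X_n \in A) <= P(U \in A) + a + (1 + a) / (n a), and the reverse inequality
   follows by taking complements; this is (4).  Since 0 <= R_n <= a a.s.,
   P(X_n <= x) <= P(U_n <= x) <= P(X_n <= x + a), so (2) follows from (4).  For (5),
   X_n + Y_n = U_n lives on a finite set, which is negligible for U. *)
Require Import Defs.
From HB Require Import structures.
From mathcomp Require Import all_boot all_order all_algebra.
From mathcomp Require Import all_classical all_reals all_analysis.
From mathcomp Require Import measurable_realfun.
From mathcomp Require Import ring lra.

Set Implicit Arguments.
Unset Strict Implicit.
Unset Printing Implicit Defensive.

Import Order.TTheory GRing.Theory Num.Theory.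
Import numFieldNormedType.Exports.

Local Open Scope classical_set_scope.
Local Open Scope ring_scope.

(** * Uniform laws and Lebesgue measure *)

Lemma uniform_probE (R : realType) (a b : R) (ab : a < b) (A : set R) :
  measurable A ->
  uniform_prob ab A = ((b - a)^-1%:E * lebesgue_measure (A `&` `[a, b]))%E.
Proof.
move=> mA; rewrite /uniform_prob integral_uniform_pdf.
under eq_integral => x.
  rewrite inE/= in_itv/= => -[_ axb]; rewrite /uniform_pdf axb.
  over.
by rewrite integral_cst//; exact: measurableI.
Qed.

(** Lebesgue measure is determined by its values on half-open intervals, whose length a shift
    preserves. *)
Lemma lebesgue_measure_translation (R : realType) (c : R) (A : set R) : measurable A ->
  pushforward (@lebesgue_measure R) (+%R^~ c : _ -> measurableTypeR R) A =
  lebesgue_measure A.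
Proof.
move=> mA; apply/esym/lebesgue_measure_unique => //=.
  exact: measurable_funD.
move=> ? _ [[x y] _ <-]; rewrite /pushforward/=.
have -> : +%R^~ c @^-1` `]x, y] = `](x - c), (y - c)]%classic.
  by apply/seteqP; split => z /=; rewrite !in_itv/= ltrBlDr lerBrDr.
rewrite !lebesgue_measure_itv/= !lte_fin ltrD2r; case: ifP => // _.
by rewrite -!EFinB; congr (_%:E); ring.
Qed.

(* Each residue class of indices modulo [K] gives disjoint subsets of [B]. *)
Lemma sum_measure_overlap d (T : measurableType d) (R : realType)
    (mu : {measure set T -> \bar R}) (n K : nat) (F : nat -> set T) (B : set T) :
  (0 < K)%N -> measurable B ->
  (forall i, measurable (F i)) ->
  (forall i, (i < n)%N -> F i `<=` B) ->
  (forall i j, (i + K <= j)%N -> F i `&` F j = set0) ->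
  (\sum_(i < n) mu (F i) <= K%:R%:E * mu B)%E.
Proof.
move=> K0 mB mF FB Fdisj.
(* Distinct indices in one residue class differ by at least [K], so [Fdisj] applies to them. *)
have modlt a b : (a < b)%N -> a = b %[mod K] -> (a + K <= b)%N.
  move=> ab /esym/eqP; rewrite eqn_mod_dvd ?(ltnW ab)// => /dvdn_leq.
  by rewrite subn_gt0 ab => /(_ isT) ?; rewrite -leq_subRL ?(ltnW ab).
rewrite (partition_big (fun i : 'I_n => Ordinal (ltn_pmod i K0)) predT)//=.
apply: (@le_trans _ _ (\sum_(j < K) mu B)%E); last first.
  by rewrite big_const_ord mule_natl iter_addr_0.
apply: lee_sum => j _.
rewrite -(@measure_bigsetU_ord_cond _ _ _ mu n _ (F \o val))//;
    [|by move=> i _; exact: mF|].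
  apply: le_measure; rewrite ?inE//.
    by apply: bigsetU_measurable => i _; exact: mF.
  elim/big_ind: _ => // [X Y XB YB|i _]; first by rewrite subUset.
  exact: FB (ltn_ord i).
  move=> i1 i2 /eqP/= <- /eqP/= [i12] /set0P; apply: contraNeq => i1i2.
  have [lt12|lt21|/val_inj] := ltngtP i1 i2; last by move/eqP: i1i2.
  - by apply/eqP/Fdisj/modlt.
  - by rewrite setIC; apply/eqP/Fdisj/modlt.
Qed.

(** * Comparison of probability laws *)

(** Both measures have total mass 1, so the inequality for the complement of [A] is the reversed
    inequality for [A]. *)
Lemma probability_le_swap d (T : measurableType d) (R : realType)
    (p q : probability T R) (e : R) :
  (forall A, measurable A -> p A <= q A + e%:E)%E ->
  (forall A, measurable A -> q A <= p A + e%:E)%E.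
Proof.
move=> pq A mA; have := pq _ (measurableC mA).
rewrite !probability_setC//.
rewrite -(fineK (fin_num_measure p A mA)) -(fineK (fin_num_measure q A mA)).
by rewrite -!EFinB -!EFinD !lee_fin; lra.
Qed.

(** The swap supplies the reverse inequality, so a one-sided bound controls the absolute
    difference. *)
Lemma dTV_le d d' (T : measurableType d) (T' : measurableType d') (R : realType)
    (P : probability T R) (Q : probability T' R)
    (X : {RV P >-> R}) (Y : {RV Q >-> R}) (e : R) :
  (forall A, measurable A ->
    distribution P X A <= distribution Q Y A + e%:E)%E ->
  (dTV X Y <= e%:E)%E.
Proof.
move=> XY; have YX := probability_le_swap XY.
apply: ge_ereal_sup => _ [A mA <-]; move: (XY A mA) (YX A mA).
move: (fin_num_measure (distribution P X) A mA).
move: (fin_num_measure (distribution Q Y) A mA).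
rewrite /=.
case: (distribution P X A) (distribution Q Y A) => [x||] [y||]//= _ _.
rewrite -!EFinD !lee_fin ler_norml => ? ?.
by apply/andP; split; lra.
Qed.

(** * Atoms and supports *)

Lemma discrete_uniform_total d (T : measurableType d) (R : realType)
    (P : probability T R) (X : {RV P >-> R}) (n : nat) :
  (0 < n)%N -> discrete_uniform X n ->
  P (\big[setU/set0]_(i < n) (X @^-1` [set i.+1%:R / n%:R])) = 1%E.
Proof.
move=> n0 Xn; have n0' : n%:R != 0 :> R by rewrite pnatr_eq0 -lt0n.
rewrite measure_bigsetU_ord//; last first.
  move=> i j _ _ [t [/= -> /(congr1 ( *%R^~ n%:R))]].
  by rewrite !divfK// => /eqP; rewrite eqr_nat => /eqP[] /val_inj.
rewrite (eq_bigr (fun=> (n%:R^-1)%:E)); last first.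
  by move=> i _; exact: (Xn i.+1 (ltn_ord i)).
by rewrite sumEFin sumr_const card_ord -(mulr_natr n%:R^-1) mulVf.
Qed.

(** The [E i] jointly carry all the mass, so their traces on [B] cover it up to a null set;
    subadditivity gives the sum. *)
Lemma probability_le_atoms d (T : measurableType d) (R : realType)
    (P : probability T R) (n : nat) (E : nat -> set T) (B : set T) :
  (forall i, measurable (E i)) -> measurable B ->
  P (\big[setU/set0]_(i < n) E i) = 1%E ->
  (P B <= \sum_(i < n) P (E i `&` B))%E.
Proof.
move=> mE mB; set S := \big[setU/set0]_(i < n) E i => S1.
have mS : measurable S by exact: bigsetU_measurable.
have mCS : measurable (~` S) by exact: measurableC.
apply: (@le_trans _ _ (P (S `&` B) + P (~` S))%E).
  apply: le_trans (measureU2 P (measurableI _ _ mS mB) mCS).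
  apply: le_measure; rewrite ?inE//.
    by apply: measurableU => //; exact: measurableI.
  by move=> x Bx; have [Sx|] := pselect (S x); [left | right].
rewrite [X in (_ + X)%E](_ : _ = 0%E) ?adde0; last first.
  by have := probability_setC P mS; rewrite S1 subee.
apply: (content_subadditive P (F := fun i => E i `&` B)) => //.
- by move=> i _; exact: measurableI.
- exact: measurableI.
- by rewrite big_distrl.
Qed.

Lemma continuous_uniform_eq0 d (T : measurableType d) (R : realType)
    (P : probability T R) (Y : {RV P >-> R}) (a b : R) (ab : a < b) (A : set R) :
  continuous_uniform Y ab -> measurable A -> A `&` `[a, b] = set0 ->
  distribution P Y A = 0%E.
Proof. by move=> Yab mA A0; rewrite Yab// uniform_probE// A0 measure0 mule0. Qed.

(** * Estimates for a fixed index *)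

Section uniform_sum.
Context {d : measure_display} {T : measurableType d} {R : realType}.
Context {d' : measure_display} {T' : measurableType d'}.
Variables (P : probability T R) (Q : probability T' R).
Variables (X Y : {RV P >-> R}) (U : {RV Q >-> R}) (n : nat) (a : R).
Hypotheses (n_gt0 : (0 < n)%N) (a_gt0 : 0 < a).
Hypotheses (X_unif : discrete_uniform X n) (Y_unif : continuous_uniform Y a_gt0).
Hypothesis U_unif : continuous_uniform U (@ltr01 R).
Hypothesis XY_indep : forall B C : set R, measurable B -> measurable C ->
  P (X @^-1` B `&` Y @^-1` C) = (P (X @^-1` B) * P (Y @^-1` C))%E.

Local Notation mu := (@lebesgue_measure R).
(** Indices start at 0, so for [j < n] the nodes are the atoms 1/n, ..., 1. The cell of [j] supports
    the law of [node j + Y]. *)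
Local Notation node j := (j.+1%:R / n%:R : R).
Local Notation cell j := (`[node j, node j + a]%classic : set R).

(** Where [X] equals [node i], the sum lies in [A] exactly when [Y] lies in a translate of [A].
    Independence gives a product, with mass 1/n from [X] and density 1/a from [Y]. *)
Lemma probability_sum_le (A : set R) : measurable A ->
  (P ((X \+ Y)%R @^-1` A) <= \sum_(i < n)
    ((n%:R * a)^-1)%:E * mu (A `&` cell i))%E.
Proof.
move=> mA.
have mX i : measurable (X @^-1` [set node i]) by exact: measurable_funPTI.
have mXY : measurable ((X \+ Y) @^-1` A).
  by rewrite -[_ @^-1` _]setTI; exact: measurable_funD.
have total := discrete_uniform_total n_gt0 X_unif.
apply: le_trans (probability_le_atoms mX mXY total) _.
apply: lee_sum => i _.
have mAi : measurable (+%R^~ (node i) @^-1` A).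
  by rewrite -[_ @^-1` _]setTI; exact: measurable_funD.
have -> : X @^-1` [set node i] `&` (X \+ Y) @^-1` A =
          X @^-1` [set node i] `&` Y @^-1` (+%R^~ (node i) @^-1` A).
  by apply/seteqP; split => t /= [-> ?]; split => //; rewrite addrC.
rewrite XY_indep// (X_unif (j := i.+1)) ?ltn_ord//.
rewrite [P (Y @^-1` _)](Y_unif mAi) uniform_probE// subr0 muleA -EFinM -invfM.
rewrite lee_pmul2l// ?lte_fin ?invr_gt0 ?mulr_gt0 ?ltr0n//.
(* Translation by [node i] carries [[0, a]] onto the cell, so the two measures are equal. *)
rewrite le_eqVlt -[X in _ == X](lebesgue_measure_translation (node i)); last first.
  exact: measurableI.
apply/orP; left; apply/eqP; rewrite /pushforward; congr (mu _).
apply/seteqP; split => x /= [Ax]; rewrite !in_itv/= => /andP[x0 xa].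
  by split => //; apply/andP; split; lra.
by split => //; apply/andP; split; lra.
Qed.

(** A finite multiple of a restricted Lebesgue measure serves both absolute continuity and the total
    variation estimate. *)
Lemma probability_sum_le_mu (A : set R) : measurable A ->
  (P ((X \+ Y)%R @^-1` A) <=
    (1 + (n%:R * a)^-1)%R%:E * mu (A `&` `[0%R, (1 + a)%R]))%E.
Proof.
move=> mA; have nN0 : n%:R != 0 :> R by rewrite pnatr_eq0 -lt0n.
have n0 : 0 < n%:R :> R by rewrite ltr0n.
have na0 : 0 < n%:R * a by rewrite mulr_gt0.
(* The least integer strictly above [n a]: [a < K / n] separates cells whose indices are [K] apart,
   and [K <= n a + 1] gives the factor 1 + 1/(n a). *)
pose K := (Num.trunc (n%:R * a)).+1.
apply: le_trans (probability_sum_le mA) _.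
rewrite -ge0_sume_distrr//.
apply: (@le_trans _ _ (((n%:R * a)^-1)%:E *
    (K%:R%:E * mu (A `&` `[0%R, (1 + a)%R]))))%E.
  rewrite lee_pmul2l// ?lte_fin ?invr_gt0//.
  apply: (@sum_measure_overlap _ _ _ mu n K (fun i => A `&` cell i)) => //.
  - exact: measurableI.
  - by move=> i; exact: measurableI.
  - move=> i i_n; apply: setIS => x /=; rewrite !in_itv/= => /andP[ix xi].
    have i0 : 0 <= node i by rewrite divr_ge0.
    have i1 : node i <= 1 by rewrite ler_pdivrMr// mul1r ler_nat.
    by apply/andP; split; lra.
  - move=> i j ij; rewrite -subset0 => x [[_ /=] + [_ /=]].
    rewrite !in_itv/= => /andP[_ xi] /andP[jx _].
    have : node i + K%:R / n%:R <= node j.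
      by rewrite -mulrDl ler_pM2r ?invr_gt0// -natrD ler_nat addSn.
    have : a < K%:R / n%:R by rewrite ltr_pdivlMr// mulrC truncnS_gt.
    by move: jx xi; lra.
rewrite muleA -EFinM lee_wpmul2r// lee_fin /K -natr1 mulrDr mulr1 lerD2r.
by rewrite mulrC ler_pdivrMr// mul1r truncn_le ltW.
Qed.

(** Applied to the complement of [[0, a]], this lets [0 <= Y <= a] be used almost surely. *)
Let null_Y (A : set R) : measurable A -> A `&` `[0, a] = set0 ->
  distribution P Y A = 0%E.
Proof. exact: continuous_uniform_eq0. Qed.

Lemma probability_sum_le_uniform (A : set R) : measurable A ->
  (P ((X \+ Y)%R @^-1` A) <= distribution Q U A +
    (a + (n%:R * a)^-1 * (1 + a))%R%:E)%E.
Proof.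
move=> mA; apply: le_trans (probability_sum_le_mu mA) _.
have na0 : 0 < n%:R * a by rewrite mulr_gt0// ltr0n.
have c0 : 0 < (n%:R * a)^-1 by rewrite invr_gt0.
have mA1 : measurable (A `&` `[0, 1]) by exact: measurableI.
(* Cutting the window from [[0, 1 + a]] down to [[0, 1]] loses at most the length [a]. *)
have le1 : (mu (A `&` `[0%R, (1 + a)%R]) <= mu (A `&` `[0%R, 1%R]) + a%:E)%E.
  have <- : mu `]1, (1 + a)] = a%:E.
    by rewrite lebesgue_measure_itv/= lte_fin ltrDl a_gt0 -EFinB addrC addKr.
  apply: le_trans (measureU2 mu mA1 _) => //; apply: le_measure; rewrite ?inE//.
  - exact: measurableI.
  - exact: measurableU.
  - move=> x [Ax]; rewrite /= !in_itv/= => /andP[x0 xa].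
    have [x1|x1] := leP x 1; last by right; apply/andP.
    by left; split => //; apply/andP.
rewrite U_unif// uniform_probE// subr0 invr1 mul1e.
have u1 : (mu (A `&` `[0%R, 1%R]) <= 1)%E.
  have <- : mu `[0, 1] = 1%E.
    by rewrite lebesgue_measure_itv/= lte_fin ltr01 -EFinB subr0.
  by apply: le_measure; rewrite ?inE.
apply: (@le_trans _ _ ((1 + (n%:R * a)^-1)%R%:E *
    (mu (A `&` `[0%R, 1%R]) + a%:E))%E).
  by rewrite lee_pmul2l// ?lte_fin ?addr_gt0//.
have : (0 <= mu (A `&` `[0%R, 1%R]))%E by [].
move: (mu (A `&` `[0%R, 1%R])) u1 => [u||]//=; rewrite -?EFinD -?EFinM !lee_fin.
(* With c = 1/(n a), (1 + c)(u + a) = u + a + c(u + a), and u <= 1. *)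
by move=> u1 u0; have := ler_wpM2l (ltW c0) u1; lra.
Qed.

(** Almost surely [Y <= a], so [X <= x] forces [X + Y <= x + a]. One [a] comes from the estimate for
    the sum, the other from moving [x + a] back to [x]. *)
Lemma cdf_le_uniform (x : R) :
  (cdf X x <= cdf U x +
    (a *+ 2 + (n%:R * a)^-1 * (1 + a))%R%:E)%E.
Proof.
pose B := (X \+ Y)%R @^-1` `]-oo, x + a].
have mB : measurable B by rewrite -[B]setTI; exact: measurable_funD.
rewrite -[cdf X x]/(P (X @^-1` `]-oo, x])).
apply: (@le_trans _ _ (P B)).
  rewrite -[P B]adde0 -(@null_Y (~` `[0, a])) ?setICl//; last exact: measurableC.
  apply: le_trans (measureU2 P mB _); last exact/measurable_funPTI/measurableC.
  apply: le_measure; rewrite ?inE//; first exact: measurable_funPTI.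
    by apply: measurableU => //; exact/measurable_funPTI/measurableC.
  move=> t /=; rewrite !in_itv/= => Xx.
  have [/andP[_ Ya]|?] := boolP (0 <= Y t <= a); [left|right; exact/negP].
  by rewrite /B/= in_itv/= lerD.
apply: le_trans (probability_sum_le_uniform _) _ => //.
rewrite mulr2n -[in leRHS]addrA [in leRHS]EFinD [leRHS]addeA; apply: leeD2r.
(* The second [a] is the length of []x, x + a]], which bounds the growth of the cdf of [U]. *)
rewrite -[a%:E](_ : mu `]x, (x + a)] = _); last first.
  by rewrite lebesgue_measure_itv/= lte_fin ltrDl a_gt0 -EFinB addrC addKr.
rewrite /cdf !U_unif// !uniform_probE// subr0 invr1 !mul1e.
apply: le_trans (measureU2 mu _ _) => //; last exact: measurableI.
apply: le_measure; rewrite ?inE//.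
- exact: measurableI.
- by apply: measurableU => //; exact: measurableI.
- move=> y [/=]; rewrite !in_itv/= => yxa y01.
  by have [yx|yx] := leP y x; [left | right; apply/andP].
Qed.

(** Almost surely [Y >= 0], so [X + Y <= x] forces [X <= x]; the point [x] does not move, and a
    single [a] remains. *)
Lemma uniform_le_cdf (x : R) :
  (cdf U x <=
    cdf X x + (a + (n%:R * a)^-1 * (1 + a))%R%:E)%E.
Proof.
(* Packaged as a random variable so that its law is a probability measure, as the swap requires. *)
pose XY : {RV P >-> R} := (X \+ Y : {mfun T >-> R}).
have swap := @probability_le_swap _ _ _ (distribution P XY)
  (distribution Q U) _ probability_sum_le_uniform.
apply: le_trans (swap _ _) _ => //; apply: leeD2r.
rewrite -[cdf X x]/(P (X @^-1` `]-oo, x])) -[leRHS]adde0.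
rewrite -[leLHS]/(P ((X \+ Y)%R @^-1` `]-oo, x])).
rewrite -(@null_Y (~` `[0, a])) ?setICl//; last exact: measurableC.
apply: le_trans (measureU2 P _ _); last 2 first.
- exact: measurable_funPTI.
- exact/measurable_funPTI/measurableC.
apply: le_measure; rewrite ?inE//.
- exact: measurable_funPTI.
- by apply: measurableU; apply: measurable_funPTI => //; exact: measurableC.
- move=> t /=; rewrite !in_itv/= => xy.
  have [/andP[Y0 _]|?] := boolP (0 <= Y t <= a); [left|right; exact/negP].
  by move: xy Y0; lra.
Qed.

End uniform_sum.

(** * Passage to the sequences *)

(** Preimages under a single [X n] or [Y n] are among the generators of the two sigma-algebras. *)
Lemma independent_sequences_preimage d (T : measurableType d) (R : realType)
    (P : probability T R) (D : set nat) (X Y : nat -> {RV P >-> R}) (n : nat) :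
  independent_sequences D X Y -> D n ->
  forall B C : set R, measurable B -> measurable C ->
  P (X n @^-1` B `&` Y n @^-1` C) = (P (X n @^-1` B) * P (Y n @^-1` C))%E.
Proof.
move=> XY Dn B C mB mC; apply: XY; apply: sub_sigma_algebra; exists n => //.
  by exists B => //; rewrite setTI.
by exists C => //; rewrite setTI.
Qed.

Theorem lemma1p17 (R : realType) (d d' : measure_display)
  (T : measurableType d) (T' : measurableType d')
  (P : probability T R) (Q : probability T' R)
  (a : nat -> R) (a_gt0 : forall n, (0 < n)%N -> 0 < a n)
  (na_pinfty : (n%:R * a n) @[n --> \oo] --> +oo)
  (a_0 : a n @[n --> \oo] --> (0 : R))
  (U_ R_ : nat -> {RV P >-> R})
  (U_unif : forall n, (0 < n)%N -> discrete_uniform (U_ n) n)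
  (R_unif : forall n (n_gt0 : (0 < n)%N), continuous_uniform (R_ n) (a_gt0 n n_gt0))
  (UR_indep : independent_sequences [set n | (0 < n)%N] U_ R_)
  (U : {RV Q >-> R}) (U_unif01 : continuous_uniform U (@ltr01 R)) :
  let X_ (n : nat) : {RV P >-> R} := (U_ n \+ R_ n : {mfun T >-> R}) in
  let Y_ (n : nat) : {RV P >-> R} := (\- R_ n : {mfun T >-> R}) in
  [/\ (forall n, (0 < n)%N ->
         distribution P (X_ n) `<< @lebesgue_measure R /\
         distribution P (Y_ n) `<< @lebesgue_measure R),
      cvg_in_distribution U_ U,
      cvg_in_probability Y_ (cst 0),
      dTV (X_ n) U @[n --> \oo] --> 0%E &
      forall n, (0 < n)%N -> dTV ((X_ n \+ Y_ n : {mfun T >-> R}) : {RV P >-> R}) U = 1%E].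
Proof.
move=> X_ Y_; pose c n := (n%:R * a n)^-1.
have indep n (n0 : (0 < n)%N) := independent_sequences_preimage UR_indep n0.
have c_0 : c n @[n --> \oo] --> (0 : R).
  (* Positivity of [n * a n] starts at [n = 1], hence holds eventually. *)
  apply/gtr0_cvgV0 => //; near=> n.
  have n0 : (0 < n)%N by near: n; exact: nbhs_infty_gt.
  by rewrite mulr_gt0 ?ltr0n// a_gt0.
have d_0 : (a n + c n * (1 + a n)) @[n --> \oo] --> (0 : R).
  rewrite -[X in _ --> X](_ : 0 + 0 * (1 + 0) = 0); last by rewrite mul0r addr0.
  by apply: cvgD => //; apply: cvgM => //; apply: cvgD => //; exact: cvg_cst.
split.
- move=> n n0; split; apply/null_content_dominatesP => A mA A0.
  + apply/eqP; rewrite -measure_le0.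
    have R_n := R_unif n n0.
    apply: le_trans (probability_sum_le_mu n0 (U_unif n n0) R_n (indep n n0) mA) _.
    rewrite (_ : lebesgue_measure _ = 0%E) ?mule0//.
    apply: (subset_measure0 _ _ (@subIsetl _ _ _)) => //.
    exact: measurableI.
  (* The law of [Y_ n] is the reflected law of [R_ n], and reflection preserves Lebesgue-null
     sets. *)
  + have mNA : measurable (-%R @^-1` A).
      by rewrite -[_ @^-1` _]setTI; exact: oppr_measurable.
    transitivity (distribution P (R_ n) (-%R @^-1` A)) => //.
    rewrite (R_unif n n0)//.
    have /null_content_dominatesP := dominates_uniform_prob (a_gt0 n n0).
    by apply => //; rewrite -A0; exact: lebesgue_measureN.
- move=> x _.
  (* The larger of the two cdf errors, used on both sides of the squeeze. *)
  pose e n := a n *+ 2 + c n * (1 + a n).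
  have e_0 : e n @[n --> \oo] --> (0 : R).
    rewrite -[X in _ --> X](addr0 (0 : R)).
    under eq_fun => n do rewrite /e mulr2n -addrA.
    exact: cvgD.
  apply: (@squeeze_cvge _ _ _ _ (fun n => cdf U x - (e n)%:E)%E _
    (fun n => cdf U x + (e n)%:E)%E).
  + near=> n.
    have n0 : (0 < n)%N by near: n; exact: nbhs_infty_gt.
    have [U_n R_n] := (U_unif n n0, R_unif n n0).
    have lo := uniform_le_cdf n0 U_n R_n U_unif01 (indep n n0) x.
    have hi := cdf_le_uniform n0 U_n R_n U_unif01 (indep n n0) x.
    apply/andP; split => //; rewrite leeBlDr//.
    apply: le_trans lo _; apply: leeD2l; rewrite lee_fin /e mulr2n -addrA.
    by rewrite lerDr ltW// a_gt0.
  + rewrite -[X in _ --> X]sube0; apply: cvgeB.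
    * by rewrite fin_num_adde_defl.
    * exact: cvg_cst.
    * by apply: cvg_EFin => //; exact: nearW.
  + rewrite -[X in _ --> X]adde0; apply: cvgeD.
    * by rewrite fin_num_adde_defl.
    * exact: cvg_cst.
    * by apply: cvg_EFin => //; exact: nearW.
(* Once [a n < eps], the event has probability exactly 0, so the sequence is eventually constant. *)
- move=> eps eps0; apply: cvg_near_cst.
  near=> n.
  have n0 : (0 < n)%N by near: n; exact: nbhs_infty_gt.
  have an : a n < eps by near: n; exact: (cvgr_lt (0:R)).
  pose B := `[eps, +oo[ `|` `]-oo, - eps] : set R.
  have -> : [set t | eps <= `|Y_ n t - cst 0 t|] = R_ n @^-1` B.
    apply/funext => t; rewrite /B/= !in_itv/= andbT subr0 normrN; apply/propext.
    rewrite real_ler_normr ?num_real// lerNr.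
    by split => [/orP|[->|->]]; rewrite ?orbT.
  apply: (continuous_uniform_eq0 (R_unif n n0)); first exact: measurableU.
  rewrite -subset0 => y [[|]]; rewrite /= !in_itv/= ?andbT => yeps /andP[y0 ya].
    by move: yeps; rewrite leNgt (le_lt_trans ya an).
  by move: yeps; rewrite leNgt (lt_le_trans _ y0)// oppr_lt0.
- apply: (@squeeze_cvge _ _ _ _ (fun=> 0%E) _ (fun n => (a n + c n * (1 + a n))%:E)).
  + near=> n.
    have n0 : (0 < n)%N by near: n; exact: nbhs_infty_gt.
    apply/andP; split.
      (* The empty set already puts a nonnegative term in the supremum. *)
      apply: le_trans (ereal_sup_ubound _); last by exists set0.
      by rewrite abse_ge0.
    have [U_n R_n] := (U_unif n n0, R_unif n n0).
    apply: dTV_le => A.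
    exact: (probability_sum_le_uniform n0 U_n R_n U_unif01 (indep n n0)).
  + exact: cvg_cst.
  + by apply: cvg_EFin => //; exact: nearW.
- move=> n n0; apply/eqP; rewrite eq_le; apply/andP; split.
    apply: dTV_le => A mA.
    apply: (@le_trans _ _ 1%E); first exact: probability_le1.
    by rewrite leeDr.
  (* The finite set of atoms is the witness: [U_ n] lies in it almost surely, while it is
     Lebesgue-null and hence null for [U]. *)
  pose S := \big[setU/set0]_(i < n) [set i.+1%:R / n%:R : R].
  have mS : measurable S by exact: bigsetU_measurable.
  apply: le_trans (ereal_sup_ubound _); last by exists S.
  have US0 : distribution Q U S = 0%E.
    rewrite U_unif01//.
    have /null_content_dominatesP := dominates_uniform_prob (@ltr01 R).
    apply => //; apply: countable_lebesgue_measure0; apply: finite_set_countable.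
    by rewrite /S; elim/big_ind: _ => // ? ? ? ?; rewrite finite_setU.
  rewrite US0 sube0 -(discrete_uniform_total n0 (U_unif n n0)) gee0_abs//.
  rewrite le_eqVlt; apply/orP; left; apply/eqP.
  transitivity (P ((X_ n \+ Y_ n)%R @^-1` S)) => //; congr (P _).
  have -> : (X_ n \+ Y_ n)%R = U_ n by apply/funext => t /=; rewrite addrK.
  by rewrite /S (big_morph _ (preimage_setU (U_ n)) (preimage_set0 _)).
Unshelve. all: by end_near.
Qed.
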